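(* Let $0<p\le 1$ and let $(X,\|\cdot\|_p)$ be a finite-dimensional real complete $p$-normed space with $\dim X\ge 2$. Then $$C_{\mathrm{NJ},p}(X)=\sup_{\eta\in[0,1]}\frac{2^{2p-1}\,L_p\!\left(\frac{1-\eta}{2},X\right)}{1+\eta^{2p}} .$$
   Context: A $p$-norm on a real vector space $X$ is a map $\|\cdot\|_p:X\to[0,\infty)$ such that (i) $\|x\|_p=0$ iff $x=0$; (ii) $\|\lambda x\|_p=|\lambda|^p\|x\|_p$ for all $\lambda\in\mathbb{R}$, $x\in X$; (iii) $\|x+y\|_p\le\|x\|_p+\|y\|_p$ for all $x,y\in X$. A (complete) $p$-normed space is a vector space with such a $p$-norm (complete for the metric $\|x-y\|_p$). Elements $x,y\in X$ are isosceles orthogonal, written $x\perp_I y$, iff $\|x+y\|_p=\|x-y\|_p$. For $t\in[0,\tfrac12]$, $$L_p(t,X)=\sup\left\{\frac{\|tx+(1-t)y\|_p^2+\|(1-t)x+ty\|_p^2}{\|x+y\|_p^2}: x,y\in X,\ (x,y)\ne(0,0),\ x\perp_I y\right\}.$$ The (generalized) von Neumann–Jordan constant is $$C_{\mathrm{NJ},p}(X)=\sup\left\{\frac{\|x+y\|_p^2+\|x-y\|_p^2}{2(\|x\|_p^2+\|y\|_p^2)}: x,y\in X,\ (x,y)\ne(0,0)\right\}.$$ *)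

(* Defs.v *)
From HB Require Import structures.
From mathcomp Require Import all_boot all_order all_algebra.
From mathcomp Require Import all_classical all_reals all_analysis.

Set Implicit Arguments.
Unset Strict Implicit.
Unset Printing Implicit Defensive.

Import Order.TTheory GRing.Theory Num.Theory.
Local Open Scope classical_set_scope.
Local Open Scope ring_scope.

Definition is_pnorm (R : realType) (p : R) (X : lmodType R) (N : X -> R) :
    Prop :=
  [/\ forall x, 0 <= N x,
      forall x, N x = 0 <-> x = 0,
      forall (a : R) x, N (a *: x) = `|a| `^ p * N x
    & forall x y, N (x + y) <= N x + N y].

(* Completeness for the metric [N (x - y)]; this metric is not declared as a
   canonical structure on [X], so it is spelled out with sequences. *)
Definition pnorm_complete (R : realType) (X : lmodType R) (N : X -> R) :
    Prop :=
  forall u : nat -> X,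
    (forall e : R, 0 < e -> exists n0 : nat, forall m n : nat,
       (n0 <= m)%N -> (n0 <= n)%N -> N (u m - u n) < e) ->
    exists l : X, forall e : R, 0 < e -> exists n0 : nat, forall n : nat,
      (n0 <= n)%N -> N (u n - l) < e.

Definition isosceles_orthogonal (R : realType) (X : lmodType R) (N : X -> R)
    (x y : X) : Prop :=
  N (x + y) = N (x - y).

(* The suprema below are real-valued ([sup] is 0 on sets that are empty or not
   bounded above). For a p-norm with 0 < p <= 1 on a nonzero space, these sets
   are nonempty and bounded above when t is in [0, 1/2]. *)
Definition Lconst (R : realType) (X : lmodType R) (N : X -> R) (t : R) : R :=
  sup [set (N (t *: z.1 + (1 - t) *: z.2) ^+ 2
            + N ((1 - t) *: z.1 + t *: z.2) ^+ 2) / N (z.1 + z.2) ^+ 2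
      | z in [set z : X * X | z <> (0, 0) /\ isosceles_orthogonal N z.1 z.2]].

Definition CNJ (R : realType) (X : lmodType R) (N : X -> R) : R :=
  sup [set (N (z.1 + z.2) ^+ 2 + N (z.1 - z.2) ^+ 2)
            / (2 * (N z.1 ^+ 2 + N z.2 ^+ 2))
      | z in [set z : X * X | z <> (0, 0)]].

(* Main.v *)
Require Import Defs.
From HB Require Import structures.
From mathcomp Require Import all_boot all_order all_algebra.
From mathcomp Require Import all_classical all_reals all_analysis.
From mathcomp Require Import ring lra.

(** The substitution [u = x + y], [v = x - y] turns isosceles orthogonality
    into [N u = N v], and with [t = (1 - eta) / 2] the two points in the
    numerator of [Lconst] become [(u - eta v) / 2] and [(u + eta v) / 2].  As
    [N (eta v) = eta ^ p N u], the factor [2 ^ (2p - 1) / (1 + eta ^ (2p))]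
    turns the quotient in [Lconst] into the von Neumann-Jordan quotient of the
    pair [(u, eta v)] ([isosceles_ratio_NJ_ratio]).  Hence the right-hand side
    is the supremum of the von Neumann-Jordan quotients of the pairs
    [(u, eta v)] with [N u = N v] and [0 <= eta <= 1].

    By homogeneity these are exactly the pairs whose second vector is not longer
    than the first ([pnorm_rescale]), and the quotient is symmetric
    ([NJ_ratioC]), so all pairs are covered and both suprema coincide.  The
    uniform bound [NJ_ratio_le2] makes the suprema genuine least upper bounds. *)

Set Implicit Arguments.
Unset Strict Implicit.
Unset Printing Implicit Defensive.

Import Order.TTheory GRing.Theory Num.Theory.
Local Open Scope classical_set_scope.
Local Open Scope ring_scope.

Lemma powR_double (R : realType) (a p : R) : a `^ (2 * p) = (a `^ p) ^+ 2.
Proof. by rewrite mulrC powRrM powR_mulrn ?powR_ge0. Qed.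

Lemma powR2_double_subr1 (R : realType) (p : R) :
  2 `^ (2 * p - 1) = (2 `^ p) ^+ 2 / 2.
Proof. by rewrite powRB ?powR_double ?powRr1 // pnatr_eq0 implybT. Qed.

Lemma scaler_halfD (R : realType) (X : lmodType R) (x : X) :
  2^-1 *: (x + x) = x.
Proof. by rewrite -(mulr2n x) -(scaler_nat 2 x) scalerA mulVf ?scale1r. Qed.

Definition NJ_ratio (R : realType) (X : lmodType R) (N : X -> R) (x y : X) : R :=
  (N (x + y) ^+ 2 + N (x - y) ^+ 2) / (2 * (N x ^+ 2 + N y ^+ 2)).

Definition isosceles_ratio (R : realType) (X : lmodType R) (N : X -> R)
    (t : R) (x y : X) : R :=
  (N (t *: x + (1 - t) *: y) ^+ 2 + N ((1 - t) *: x + t *: y) ^+ 2)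
    / N (x + y) ^+ 2.

Section PNorm.
Variables (R : realType) (p : R) (X : lmodType R) (N : X -> R).
Hypothesis p_gt0 : 0 < p.
Hypothesis N_pnorm : is_pnorm p N.

Lemma pnorm_ge0 x : 0 <= N x.
Proof. by case: N_pnorm. Qed.

Lemma pnorm_eq0 x : N x = 0 <-> x = 0.
Proof. by case: N_pnorm. Qed.

Lemma pnorm0 : N 0 = 0.
Proof. exact/pnorm_eq0. Qed.

Lemma pnormZ a x : N (a *: x) = `|a| `^ p * N x.
Proof. by case: N_pnorm. Qed.

Lemma pnormD x y : N (x + y) <= N x + N y.
Proof. by case: N_pnorm. Qed.

Lemma pnorm_gt0 x : x <> 0 -> 0 < N x.
Proof.
move=> x0; rewrite lt_neqAle pnorm_ge0 andbT.
by apply/eqP => Nx; apply/x0/pnorm_eq0.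
Qed.

Lemma pnormN x : N (- x) = N x.
Proof. by rewrite -scaleN1r pnormZ normrN1 powR1 mul1r. Qed.

Lemma pnormB x y : N (x - y) <= N x + N y.
Proof. by rewrite -(pnormN y) pnormD. Qed.

Lemma pnorm_half x : N (2^-1 *: x) = N x / 2 `^ p.
Proof.
rewrite pnormZ gtr0_norm ?invr_gt0// -powR_inv1// -powRrM mulN1r powRN.
by rewrite mulrC.
Qed.

Lemma NJ_ratioC x y : NJ_ratio N x y = NJ_ratio N y x.
Proof.
by rewrite /NJ_ratio -(pnormN (x - y)) opprB [y + x]addrC [N y ^+ 2 + _]addrC.
Qed.

(** The triangle inequality bounds the numerator by twice
    [(N x + N y) ^ 2 <= 2 (N x ^ 2 + N y ^ 2)]. *)
Lemma NJ_ratio_le2 x y : NJ_ratio N x y <= 2.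
Proof.
have sq w : 0 <= w <= N x + N y -> w ^+ 2 <= 2 * (N x ^+ 2 + N y ^+ 2).
  by case/andP=> w0 wle; have := sqr_ge0 (N x - N y); nra.
have plus : N (x + y) ^+ 2 <= 2 * (N x ^+ 2 + N y ^+ 2).
  by apply: sq; rewrite pnorm_ge0 pnormD.
have minus : N (x - y) ^+ 2 <= 2 * (N x ^+ 2 + N y ^+ 2).
  by apply: sq; rewrite pnorm_ge0 pnormB.
rewrite /NJ_ratio; set D := 2 * _ in plus minus *.
have [D0|D_gt0] := leP D 0; last by rewrite ler_pdivrMr//; lra.
have -> : D = 0.
  apply/eqP; rewrite eq_le D0 /= mulr_ge0// addr_ge0// exprn_ge0//;
  exact: pnorm_ge0.
by rewrite invr0 mulr0.
Qed.

(** If the two diagonals of an isosceles pair vanish, so does the pair; hence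
    the denominator in [isosceles_ratio] is positive. *)
Lemma isosceles_pnormD_gt0 x y :
  (x, y) <> (0, 0) -> isosceles_orthogonal N x y -> 0 < N (x + y).
Proof.
move=> xy0 iso; apply: pnorm_gt0 => sum0; apply: xy0.
have diff0 : x - y = 0 by apply/pnorm_eq0; rewrite -iso sum0 pnorm0.
have xE : x = 2^-1 *: ((x + y) + (x - y)).
  by rewrite addrACA subrr addr0 scaler_halfD.
have x0 : x = 0 by rewrite xE sum0 diff0 addr0 scaler0.
by move: sum0; rewrite x0 add0r => ->.
Qed.

(** In terms of [u = x + y] and [v = x - y], the halves in
    [(u - eta v) / 2] and [(u + eta v) / 2] contribute [2 ^ (-2p)], leaving a
    factor [1 / 2], and [N v = N u] turns [(1 + eta ^ (2p)) N u ^ 2] into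
    [N u ^ 2 + N (eta v) ^ 2]. *)
Lemma isosceles_ratio_NJ_ratio eta x y : 0 <= eta ->
  (x, y) <> (0, 0) -> isosceles_orthogonal N x y ->
  2 `^ (2 * p - 1) * isosceles_ratio N ((1 - eta) / 2) x y
    / (1 + eta `^ (2 * p)) = NJ_ratio N (x + y) (eta *: (x - y)).
Proof.
move=> eta0 xy0 iso; have Nu0 := isosceles_pnormD_gt0 xy0 iso.
have comb (a b c d : R) : a = 2^-1 * (1 + c) -> b = 2^-1 * (1 - c) -> d = c ->
    a *: x + b *: y = 2^-1 *: ((x + y) + d *: (x - y)).
  move=> -> -> ->; rewrite -!scalerA -scalerDr; congr (_ *: _).
  by rewrite scalerBr !scalerDl !scale1r scaleNr addrACA.
have tE : (1 - eta) / 2 *: x + (1 - (1 - eta) / 2) *: y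
    = 2^-1 *: ((x + y) - eta *: (x - y)).
  by rewrite (@comb _ _ (- eta) (- eta)) ?scaleNr//; field.
have tE' : (1 - (1 - eta) / 2) *: x + (1 - eta) / 2 *: y
    = 2^-1 *: ((x + y) + eta *: (x - y)).
  by rewrite (@comb _ _ eta eta)//; field.
rewrite /isosceles_ratio /NJ_ratio tE tE' !pnorm_half powR2_double_subr1.
rewrite powR_double pnormZ (ger0_norm eta0) -iso.
have c0 : 0 < 2 `^ p :> R by exact: powR_gt0.
have d0 : 0 <= eta `^ p by exact: powR_ge0.
move: (2 `^ p) (eta `^ p) (N (x + y)) Nu0 c0 d0 => c d n n0 c0 d0.
field; rewrite !gt_eqF//; nra.
Qed.

(** Since [N] is homogeneous of degree [p], the scale is
    [eta = (N y / N x) ^ (1 / p)]; when [y = 0], [eta = 0] and any [v] as long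
    as [x] will do. *)
Lemma pnorm_rescale x y : x <> 0 -> N y <= N x ->
  exists eta v, [/\ 0 <= eta <= 1, N v = N x & y = eta *: v].
Proof.
move=> x0 yx; have Nx := pnorm_gt0 x0.
have [->|/eqP y0] := eqVneq y 0.
  by exists 0, x; rewrite lexx ler01 scale0r.
have Ny := pnorm_gt0 y0.
have r0 : 0 < N y / N x by rewrite divr_gt0.
pose eta := (N y / N x) `^ p^-1.
have eta0 : 0 < eta by rewrite powR_gt0.
exists eta, (eta^-1 *: y); split.
- rewrite ltW//= -(powRr0 (N y / N x)).
  rewrite ger_powR ?invr_ge0 ?(ltW p_gt0)// r0 ler_pdivrMr// mul1r.
  exact: yx.
- rewrite pnormZ gtr0_norm ?invr_gt0// -powR_inv1 ?(ltW eta0)// -powRrM mulN1r.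
  rewrite powRN /eta -powRrM mulVf ?gt_eqF// powRr1 ?(ltW r0)//.
  by rewrite invf_div mulfVK// gt_eqF.
- by rewrite scalerA divff ?scale1r// gt_eqF.
Qed.

(** Converse to [isosceles_ratio_NJ_ratio]: order the pair by symmetry, write
    the shorter vector as [eta v] with [N v = N x], and undo the change of
    variables by taking [((x + v) / 2, (x - v) / 2)]. *)
Lemma NJ_ratio_isosceles_ratio x y : (x, y) <> (0, 0) ->
  exists eta a b, [/\ 0 <= eta <= 1, (a, b) <> (0, 0),
    isosceles_orthogonal N a b &
    NJ_ratio N x y = 2 `^ (2 * p - 1) * isosceles_ratio N ((1 - eta) / 2) a b
                       / (1 + eta `^ (2 * p))].
Proof.
wlog yx : x y / N y <= N x.
  move=> ordered xy0; have [|/ltW xy] := leP (N y) (N x).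
    by move=> /ordered; apply.
  by rewrite NJ_ratioC; apply: ordered => // -[y0 x0]; apply: xy0; rewrite x0 y0.
move=> xy0; have x0 : x <> 0.
  move=> x0; apply: xy0; move: yx; rewrite x0 pnorm0 => Ny; congr pair.
  by apply/pnorm_eq0/eqP; rewrite eq_le Ny pnorm_ge0.
have [eta [v [eta01 Nv yE]]] := pnorm_rescale x0 yx.
pose a := 2^-1 *: (x + v); pose b := 2^-1 *: (x - v).
have abD : a + b = x by rewrite -scalerDr addrACA subrr addr0 scaler_halfD.
have abB : a - b = v by rewrite -scalerBr opprB addrC addrA subrK scaler_halfD.
have ab0 : (a, b) <> (0, 0) by case=> a0 b0; apply: x0; rewrite -abD a0 b0 addr0.
have iso : isosceles_orthogonal N a b by rewrite /isosceles_orthogonal abD abB.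
exists eta, a, b; split=> //; case/andP: eta01 => eta0 _.
by rewrite isosceles_ratio_NJ_ratio// abD abB -yE.
Qed.

Lemma NJ_ratio_le_CNJ x y : (x, y) <> (0, 0) -> NJ_ratio N x y <= CNJ N.
Proof.
move=> xy0; apply: ub_le_sup; last by exists (x, y).
by exists 2 => _ [z _ <-]; exact: NJ_ratio_le2.
Qed.

(** The quotient bound by [CNJ N / isosceles_weight eta] is uniform in the
    isosceles pair, so it both makes [Lconst] an honest supremum and bounds it. *)
Definition isosceles_weight eta : R :=
  2 `^ (2 * p - 1) / (1 + eta `^ (2 * p)).

Lemma isosceles_weight_gt0 eta : 0 < isosceles_weight eta.
Proof. by rewrite divr_gt0 ?powR_gt0// ltr_pwDl// powR_ge0. Qed.

Lemma isosceles_ratio_le_CNJ eta x y : 0 <= eta ->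
  (x, y) <> (0, 0) -> isosceles_orthogonal N x y ->
  isosceles_ratio N ((1 - eta) / 2) x y <= CNJ N / isosceles_weight eta.
Proof.
move=> eta0 xy0 iso; rewrite ler_pdivlMr ?isosceles_weight_gt0//.
rewrite mulrC mulrAC isosceles_ratio_NJ_ratio//; apply: NJ_ratio_le_CNJ => -[u0 _].
by have := isosceles_pnormD_gt0 xy0 iso; rewrite u0 pnorm0 ltxx.
Qed.

Lemma isosceles_ratio_le_Lconst eta x y : 0 <= eta ->
  (x, y) <> (0, 0) -> isosceles_orthogonal N x y ->
  isosceles_ratio N ((1 - eta) / 2) x y <= Lconst N ((1 - eta) / 2).
Proof.
move=> eta0 xy0 iso; apply: ub_le_sup; last by exists (x, y).
exists (CNJ N / isosceles_weight eta) => _ [z [z0 ziso] <-].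
by apply: isosceles_ratio_le_CNJ => //; rewrite -surjective_pairing.
Qed.

Lemma weighted_Lconst_le_CNJ eta : (exists x : X, x <> 0) -> 0 <= eta ->
  2 `^ (2 * p - 1) * Lconst N ((1 - eta) / 2) / (1 + eta `^ (2 * p)) <= CNJ N.
Proof.
move=> [x x0] eta0; rewrite mulrAC mulrC -ler_pdivlMr ?isosceles_weight_gt0//.
apply: ge_sup.
  exists (isosceles_ratio N ((1 - eta) / 2) x 0), (x, 0) => //.
  by split; [case | rewrite /isosceles_orthogonal /= addr0 subr0].
move=> _ [z [z0 ziso] <-].
by apply: isosceles_ratio_le_CNJ => //; rewrite -surjective_pairing.
Qed.

End PNorm.

Theorem theorem3p3 (R : realType) (p : R) (X : vectType R) (N : X -> R)
    (p_gt0 : 0 < p) (p_le1 : p <= 1)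
    (N_pnorm : is_pnorm p N) (N_complete : pnorm_complete N)
    (dim_ge2 : (2 <= \dim {: X})%N) :
  CNJ N = sup [set 2 `^ (2 * p - 1) * Lconst N ((1 - eta) / 2)
                   / (1 + eta `^ (2 * p))
              | eta in [set eta : R | 0 <= eta <= 1]].
Proof.
have X_neq0 : exists x : X, x <> 0.
  exists (vpick {: X}); apply/eqP; rewrite vpick0 -dimv_eq0.
  by rewrite -lt0n (leq_trans _ dim_ge2).
apply/eqP; rewrite eq_le; apply/andP; split; apply: ge_sup.
- by have [x x0] := X_neq0; exists (NJ_ratio N x 0), (x, 0) => //; case.
- move=> _ [[x y] xy0 <-].
  have [eta [a [b [eta01 ab0 iso ratioE]]]] :=
    NJ_ratio_isosceles_ratio p_gt0 N_pnorm xy0.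
  have [eta0 _] := andP eta01.
  rewrite [leLHS]ratioE; apply: le_trans (ub_le_sup _ _); first last.
  + by exists eta.
  + by exists (CNJ N) => _ [e /andP[e0 _] <-]; exact: weighted_Lconst_le_CNJ.
  rewrite ler_pM2r ?invr_gt0 ?ltr_pwDl ?powR_ge0// ler_pM2l ?powR_gt0//.
  exact: (isosceles_ratio_le_Lconst N_pnorm).
- by exists (2 `^ (2 * p - 1) * Lconst N ((1 - 0) / 2) / (1 + 0 `^ (2 * p))), 0;
    rewrite //= lexx ler01.
- by move=> _ [eta /andP[eta0 _] <-]; exact: weighted_Lconst_le_CNJ.
Qed.
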